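(* Let $f,h:\mathbb{N}\to\mathbb{Q}$ be bijections and let $\pi$ be a permutation of $\mathbb{N}$. The following are equivalent: (a) $\pi:G_f\to G_h$ is a graph isomorphism. (b) $(e_{f,n})_n$ and $(e_{h,\pi(n)})_n$ are isometrically equivalent. (c) $\pi=\mathrm{id}$ and there is an order isomorphism $e$ of $\mathbb{Q}$ (onto itself) such that $f=e\circ h$.
   Context: For a bijection $f:\mathbb{N}\to\mathbb{Q}$, define a partial order on $\mathbb{N}$ by $n\le_fk$ iff $n\le k$ and $f(n)\le f(k)$. The Sierpiński graph $G_f$ is its comparability graph: its vertex set is $\mathbb{N}$, and $\{n,k\}$ with $n\ne k$ is an edge iff $n\le_fk$ or $k\le_fn$. Let $\mathcal{C}_f$ be the family of all finite cliques of $G_f$, $\|x\|_f=\sup\{\sum_{i\in F}|x(i)|:F\in\mathcal{C}_f\}$ for $x\in\mathbb{R}^{\mathbb{N}}$, and let $X_f=\{x\in\mathbb{R}^{\mathbb{N}}:\|x\cdot\chi_{[n,\infty)}\|_f\to0\}$, a Banach space under $\|\cdot\|_f$ (the Sierpiński space) with basis the unit vectors $(e_{f,n})_n$. Sequences $(a_n),(b_n)$ in Banach spaces are isometrically equivalent if $\|\sum_nc_na_n\|=\|\sum_nc_nb_n\|$ for all finitely supported real sequences $(c_n)$. *)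

(* Defs.v *)
From HB Require Import structures.
From mathcomp Require Import all_boot all_order all_algebra finmap.
From mathcomp Require Import all_classical all_reals all_analysis.

Set Implicit Arguments.
Unset Strict Implicit.
Unset Printing Implicit Defensive.
Import Order.TTheory GRing.Theory Num.Theory numFieldNormedType.Exports.
Local Open Scope classical_set_scope.
Local Open Scope ring_scope.

Definition sierpinski_le (f : nat -> rat) : rel nat :=
  fun n k => (n <= k)%N && (f n <= f k).

Definition sierpinski_graph (f : nat -> rat) : rel nat :=
  fun n k => (n != k) && (sierpinski_le f n k || sierpinski_le f k n).

Definition graph_isomorphism (T U : Type) (E : rel T) (E' : rel U)
    (p : T -> U) : Prop :=
  bijective p /\ {mono p : x y / E x y >-> E' x y}.

Definition order_isomorphism d d' (T : porderType d) (U : porderType d')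
    (p : T -> U) : Prop :=
  bijective p /\ {mono p : x y / (x <= y)%O}.

Definition finite_cliques (f : nat -> rat) : set {fset nat} :=
  [set F | {in F &, forall n k, n != k -> sierpinski_graph f n k}].

Section SierpinskiSpace.
Context {R : realType}.
Implicit Types (f : nat -> rat) (x y : nat -> R).

(* Valued in \bar R: it is +oo on sequences that are unbounded on cliques.
   The empty clique contributes the sum 0. *)
Definition sierpinski_norm f x : \bar R :=
  ereal_sup [set (\sum_(i <- F) `|x i|)%:E | F in finite_cliques f].

(* \1_A is the indicator function of A, so the sequence below is the restriction
   of x to [n, oo). *)
Definition in_sierpinski_space f x : Prop :=
  sierpinski_norm f (x \* \1_[set i | (n <= i)%N]) @[n --> \oo] --> 0%E.

Lemma sierpinski_norm_ub f x F : finite_cliques f F ->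
  ((\sum_(i <- F) `|x i|)%:E <= sierpinski_norm f x)%E.
Proof. by move=> cF; apply: ereal_sup_ubound; exists F. Qed.

Lemma sierpinski_norm_le f x (a : \bar R) :
  (forall F, finite_cliques f F -> ((\sum_(i <- F) `|x i|)%:E <= a)%E) ->
  (sierpinski_norm f x <= a)%E.
Proof. by move=> H; apply: ge_ereal_sup => _ [F cF <-]; exact: H. Qed.

Lemma sierpinski_norm_ge0 f x : (0 <= sierpinski_norm f x)%E.
Proof.
have /(sierpinski_norm_ub x) : finite_cliques f fset0 by [].
by apply: le_trans; rewrite big_seq_fset0.
Qed.

Lemma sierpinski_norm_coord f x i : (`|x i|%:E <= sierpinski_norm f x)%E.
Proof.
have /(sierpinski_norm_ub x) : finite_cliques f [fset i]%fset.
  by move=> n k; rewrite !inE => /eqP -> /eqP ->; rewrite eqxx.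
by rewrite big_seq_fset1.
Qed.

Lemma sierpinski_normD f x y :
  (sierpinski_norm f (x + y)%R <= sierpinski_norm f x + sierpinski_norm f y)%E.
Proof.
apply: sierpinski_norm_le => F cF.
apply: (@le_trans _ _ (\sum_(i <- F) `|x i| + \sum_(i <- F) `|y i|)%:E).
  by rewrite lee_fin -big_split/=; apply: ler_sum => i _; exact: ler_normD.
by rewrite EFinD; apply: leeD; exact: sierpinski_norm_ub.
Qed.

Lemma sierpinski_normZ f (a : R) x :
  sierpinski_norm f (a *: x) = (`|a|%:E * sierpinski_norm f x)%E.
Proof.
have le_normZ b z :
    (sierpinski_norm f (b *: z) <= `|b|%:E * sierpinski_norm f z)%E.
  apply: sierpinski_norm_le => F cF.
  have -> : \sum_(i <- F) `|(b *: z) i| = `|b| * \sum_(i <- F) `|z i|.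
    by rewrite mulr_sumr; apply: eq_bigr => i _; rewrite -normrM.
  by rewrite EFinM lee_wpmul2l// ?lee_fin//; exact: sierpinski_norm_ub.
apply/eqP; rewrite eq_le le_normZ/=.
have [->|a0] := eqVneq a 0; first by rewrite normr0 mul0e sierpinski_norm_ge0.
have := le_normZ a^-1 (a *: x); rewrite scalerA mulVf// scale1r normfV.
rewrite -(@lee_pmul2l _ `|a|%:E)// ?lte_fin ?normr_gt0//.
by rewrite muleA -EFinM divff ?normr_eq0// mul1e.
Qed.

Lemma sierpinski_norm_mono f x y : (forall i, `|x i| <= `|y i|) ->
  (sierpinski_norm f x <= sierpinski_norm f y)%E.
Proof.
move=> xy; apply: sierpinski_norm_le => F cF.
apply: le_trans (sierpinski_norm_ub y cF).
by rewrite lee_fin; apply: ler_sum.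
Qed.

Lemma sierpinski_norm0 f : sierpinski_norm f (0 : nat -> R) = 0%E.
Proof.
have := sierpinski_normZ f 0 (0 : nat -> R).
by rewrite scale0r normr0 mul0e.
Qed.

Lemma tailD x y (A : set nat) : (x + y) \* \1_A = x \* \1_A + y \* \1_A.
Proof. by apply/funext => i; exact: mulrDl. Qed.

Lemma tailZ a x (A : set nat) : (a *: x) \* \1_A = a *: (x \* \1_A).
Proof. by apply/funext => i; rewrite /= -mulrA. Qed.

Lemma tail_le x (A : set nat) i : `|(x \* \1_A) i| <= `|x i|.
Proof.
rewrite /= normrM ler_piMr// indicE.
by case: (i \in A); rewrite ?normr1 ?normr0.
Qed.

Lemma in_sierpinski_spaceP f x : in_sierpinski_space f x <->
  forall e : R, 0 < e -> exists n : nat,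
    (sierpinski_norm f (x \* \1_[set i | (n <= i)%N])%R <= e%:E)%E.
Proof.
split=> [/fine_cvgP[fin0 /cvgrPdist_le cvg0] e e0|H].
  have [N _ HN] := fin0; have [M _ HM] := cvg0 _ e0.
  exists (maxn N M); rewrite -[leLHS]fineK; last by apply: HN => /=; rewrite leq_maxl.
  rewrite lee_fin; apply: le_trans (HM (maxn N M) _); last by rewrite /= leq_maxr.
  by rewrite /= sub0r normrN ler_norm.
have anti n m : (n <= m)%N ->
    (sierpinski_norm f (x \* \1_[set i | (m <= i)%N])%R <=
     sierpinski_norm f (x \* \1_[set i | (n <= i)%N])%R)%E.
  move=> nm; apply: sierpinski_norm_mono => i /=.
  rewrite !normrM ler_wpM2l// !indicE.
  have [mi|mi] := boolP (m <= i)%N.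
    by rewrite !mem_set//=; exact: leq_trans mi.
  rewrite memNset ?normr0//=; exact/negP.
apply/fine_cvgP; split.
  have [N HN] := H _ ltr01; exists N => // m /= Nm.
  rewrite ge0_fin_numE ?sierpinski_norm_ge0//.
  by apply: le_lt_trans (anti _ _ Nm) _; apply: le_lt_trans HN _; rewrite ltry.
apply/cvgrPdist_le => e e0; have [N HN] := H _ e0; exists N => // m /= Nm.
have mN := le_trans (anti _ _ Nm) HN.
rewrite sub0r normrN ger0_norm ?fine_ge0 ?sierpinski_norm_ge0//.
rewrite -lee_fin fineK// ge0_fin_numE ?sierpinski_norm_ge0//.
by apply: le_lt_trans mN _; rewrite ltry.
Qed.

Lemma sierpinski_norm_fin f x : in_sierpinski_space f x ->
  sierpinski_norm f x \is a fin_num.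
Proof.
move=> /in_sierpinski_spaceP/(_ _ ltr01)[N HN].
rewrite ge0_fin_numE ?sierpinski_norm_ge0//.
pose t := x \* \1_[set i | (N <= i)%N].
have -> : x = t + (x - t) by rewrite addrC subrK.
apply: le_lt_trans (sierpinski_normD _ _ _) _.
apply: (@le_lt_trans _ _ (1%:E + (\sum_(i < N) `|x i|)%:E)%E); last by rewrite ltry.
apply: leeD => //; apply: sierpinski_norm_le => F cF; rewrite lee_fin.
have z i : (N <= i)%N -> (x - t) i = 0.
  by move=> Ni; rewrite !fctE /t/= indicE mem_set//= mulr1 subrr.
have w i : (i < N)%N -> (x - t) i = x i.
  move=> iN; rewrite !fctE /t/= indicE memNset/= ?mulr0 ?subr0//.
  by apply/negP; rewrite -ltnNge.
rewrite (bigID (fun i => i < N)%N)/= [X in _ + X]big1 ?addr0; last first.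
  by move=> i; rewrite -leqNgt => /z ->; rewrite normr0.
rewrite (eq_bigr (fun i => `|x i|)) => [|i /w -> //].
rewrite -big_filter -(big_mkord xpredT (fun i => `|x i|)) /index_iota subn0.
rewrite [leRHS](bigID (mem F))/= -[leLHS]addr0.
apply: lerD; last exact: sumr_ge0.
rewrite le_eqVlt -[X in _ == X]big_filter; apply/orP; left; apply/eqP.
apply/perm_big/uniq_perm; rewrite ?filter_uniq ?iota_uniq ?fset_uniq//.
by move=> i; rewrite !mem_filter mem_iota add0n andbC.
Qed.

Record sierpinski_space f := SierpinskiSpace {
  sierpinski_val :> nat -> R;
  _ : sierpinski_val \in [pred x | `[< in_sierpinski_space f x >]] }.

HB.instance Definition _ f := [isSub for @sierpinski_val f].
HB.instance Definition _ f := [Choice of sierpinski_space f by <:].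

Lemma sierpinski_space_closed f :
  GRing.subsemimod_closed [pred x | `[< @in_sierpinski_space f x >]].
Proof.
split; last first.
  move=> a x /asboolP/in_sierpinski_spaceP H; apply/asboolP/in_sierpinski_spaceP.
  move=> e e0; have [|N HN] := H (e / (`|a| + 1)).
    by rewrite divr_gt0// ltr_wpDl.
  exists N; rewrite tailZ sierpinski_normZ.
  apply: le_trans (lee_wpmul2l _ HN) _; first by rewrite lee_fin.
  rewrite -EFinM lee_fin mulrCA ler_piMr ?(ltW e0)//.
  by rewrite ler_pdivrMr ?mul1r ?lerDl// ltr_wpDl.
split.
  apply/asboolP/in_sierpinski_spaceP => e e0; exists 0.
  apply: (@le_trans _ _ (sierpinski_norm f 0)).
    by apply: sierpinski_norm_mono; exact: tail_le.
  by rewrite sierpinski_norm0 lee_fin ltW.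
move=> x y /asboolP xX /asboolP yX; apply/asboolP.
have := cvgeD _ xX yX; rewrite adde0 => /(_ _ erefl) xyX.
apply: (squeeze_cvge _ (cvg_cst 0%E) xyX).
apply: nearW => n; rewrite sierpinski_norm_ge0/= tailD; exact: sierpinski_normD.
Qed.

HB.instance Definition _ f := GRing.isSubmodClosed.Build R (nat -> R)
  [pred x | `[< @in_sierpinski_space f x >]] (sierpinski_space_closed f).
HB.instance Definition _ f := [SubChoice_isSubLmodule of sierpinski_space f by <:].

Lemma sierpinski_spaceP f (x : sierpinski_space f) :
  in_sierpinski_space f x.
Proof. by case: x => x /= /asboolP. Qed.

Section norm.
Variable f : nat -> rat.
Let X := sierpinski_space f.

Let norm (x : X) : R := fine (sierpinski_norm f x).

Let normE (x : X) : (norm x)%:E = sierpinski_norm f x.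
Proof. by rewrite fineK// sierpinski_norm_fin//; exact: sierpinski_spaceP. Qed.

Let norm_triangle (x y : X) : norm (x + y) <= norm x + norm y.
Proof. by rewrite -lee_fin EFinD !normE; exact: sierpinski_normD. Qed.

Let normZ (a : R) (x : X) : norm (a *: x) = `|a| * norm x.
Proof. by apply: EFin_inj; rewrite EFinM !normE; exact: sierpinski_normZ. Qed.

Let norm_eq0 (x : X) : norm x = 0 -> x = 0.
Proof.
move=> x0; apply/val_inj/funext => i; apply/normr0_eq0/eqP.
by rewrite eq_le normr_ge0 andbT -lee_fin -x0 normE sierpinski_norm_coord.
Qed.

HB.instance Definition _ :=
  Lmodule_isNormed.Build R (sierpinski_space f) norm_triangle normZ norm_eq0.

Lemma sierpinski_normE (x : X) : `|x|%:E = sierpinski_norm f x.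
Proof. exact: normE. Qed.

End norm.

Lemma sierpinski_space_complete f (F : set_system (sierpinski_space f)) :
  ProperFilter F -> cauchy F -> cvg F.
Proof.
move=> PF /cauchy_ballP cF.
have near_dist (e : R) : 0 < e -> \forall x \near F & y \near F, `|x - y| <= e.
  move=> e0; have := cF e e0; apply: filterS => -[x y] /=.
  by rewrite -ball_normE => /ltW.
have coord_cvg i : cvg ((fun x : sierpinski_space f => x i) @ F).
  apply: cauchy_cvg; apply/cauchy_ballP => e e0.
  have e20 : 0 < e / 2 by rewrite divr_gt0.
  have [[A B] /= [FA FB] AB] := near_dist _ e20.
  exists ((fun x : sierpinski_space f => x i) @` A,
          (fun x : sierpinski_space f => x i) @` B).
    by split; [apply: filterS FA|apply: filterS FB] => z ?; exists z.
  move=> [_ _] /= [[x Ax <-] [y By <-]].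
  rewrite -ball_normE /=; apply: (@le_lt_trans _ _ (e / 2)).
    rewrite -lee_fin; apply: le_trans (sierpinski_norm_coord f (x - y : sierpinski_space f) i) _.
    by rewrite -sierpinski_normE lee_fin; exact: (AB (x, y)).
  by rewrite ltr_pdivrMr// ltr_pMr// ltr1n.
pose y i : R := lim ((fun x : sierpinski_space f => x i) @ F).
have yE e : 0 < e ->
    \forall x \near F,
      (sierpinski_norm f (y - (x : sierpinski_space f) : nat -> R)%R <= e%:E)%E.
  move=> e0; have [[A B] /= [FA FB] AB] := near_dist _ e0.
  apply: filterS FA => x Ax.
  apply: sierpinski_norm_le => C cC; rewrite lee_fin.
  have cvgC : (fun z : sierpinski_space f => \sum_(i <- C) `|z i - x i|) @ F -->
      \sum_(i <- C) `|y i - x i|.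
    apply: cvg_big => [|i _]; first exact: add_continuous.
    by apply: cvg_norm; apply: cvgB; [exact: coord_cvg|exact: cvg_cst].
  apply: (cvgr_to_le cvgC).
  apply: filterS FB => z Bz /=; rewrite -lee_fin.
  apply: le_trans (sierpinski_norm_ub (z - x : sierpinski_space f) cC) _.
  by rewrite -sierpinski_normE lee_fin distrC; exact: (AB (x, z)).
have yX : in_sierpinski_space f y.
  apply/in_sierpinski_spaceP => e e0.
  have e20 : 0 < e / 2 by rewrite divr_gt0.
  have [x xe] := filter_ex (yE _ e20).
  have [N HN] := (in_sierpinski_spaceP _ _).1 (sierpinski_spaceP x) _ e20.
  exists N; have -> : y = (x : nat -> R) + (y - (x : nat -> R)) by rewrite addrC subrK.
  rewrite tailD; apply: le_trans (sierpinski_normD _ _ _) _.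
  rewrite [e]splitr EFinD; apply: leeD => //.
  by apply: le_trans xe; apply: sierpinski_norm_mono; exact: tail_le.
have yP : y \in [pred x | `[< in_sierpinski_space f x >]] by exact/asboolP.
apply/cvg_ex; exists (SierpinskiSpace yP).
apply/cvgrPdist_le => e e0; have := yE e e0; apply: filterS => x xe.
by rewrite -lee_fin sierpinski_normE.
Qed.

HB.instance Definition _ f :=
  Uniform_isComplete.Build (sierpinski_space f) (@sierpinski_space_complete f).

Lemma unit_vector_in_space f n :
  (fun i => (i == n)%:R) \in [pred x | `[< in_sierpinski_space f x >]].
Proof.
apply/asboolP/in_sierpinski_spaceP => e e0; exists n.+1.
apply: (@le_trans _ _ 0%E); last by rewrite lee_fin ltW.
apply: sierpinski_norm_le => F _; rewrite big1// => i _ /=.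
have [->|] := eqVneq i n; last by rewrite mul0r normr0.
by rewrite indicE memNset/= ?ltnn// mulr0 normr0.
Qed.

Definition unit_vector f n : sierpinski_space f :=
  SierpinskiSpace (unit_vector_in_space f n).

End SierpinskiSpace.
Arguments sierpinski_space R f : clear implicits.
Arguments unit_vector R f n : clear implicits.

(* {fsfun nat -> R with 0} is the type of finitely supported sequences. *)
Definition isometrically_equivalent (R : realType)
    (V W : completeNormedModType R) (a : nat -> V) (b : nat -> W) : Prop :=
  forall c : {fsfun nat -> R with 0},
    `|\sum_(n <- finsupp c) c n *: a n| = `|\sum_(n <- finsupp c) c n *: b n|.

(* Main.v *)
(* The graph determines the order of the values: up to finitely many vertices,
   the neighbours of [n] are the [k] with [f n < f k], so [f n <= f m] holds iff
   almost every neighbour of [m] is a neighbour of [n].  Once the order of the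
   values is known, [n < m] for [f n < f m] just says that [n] and [m] are
   adjacent, so the usual order of [nat] is determined as well; a graph
   isomorphism is thus increasing, hence the identity.  On the Banach space side
   adjacency of [n] and [k] is read off [`|e_n + e_k|], which is 2 or 1. *)
Require Import Defs.
From mathcomp Require Import all_boot all_order all_algebra finmap.
From mathcomp Require Import all_classical all_reals all_analysis.

Set Implicit Arguments.
Unset Strict Implicit.
Unset Printing Implicit Defensive.
Import Order.TTheory GRing.Theory Num.Theory numFieldNormedType.Exports.
Local Open Scope classical_set_scope.
Local Open Scope ring_scope.

(** A strictly increasing map on [nat] never falls below its argument. This applies to [p] and to
    its inverse [q], which leaves only the identity. *)
Lemma bij_homo_lt_id (p : nat -> nat) :
  bijective p -> {homo p : n k / (n < k)%N} -> p = id.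
Proof.
move=> [q pK qK] p_lt; apply/funext => n.
have p_ge k : (k <= p k)%N.
  by elim: k => // k IH; apply: leq_ltn_trans IH (p_lt _ _ (ltnSn k)).
have q_lt : {homo q : i k / (i < k)%N}.
  move=> i k; apply: contraTT; rewrite -!leqNgt leq_eqVlt => /orP[/eqP e|/p_lt].
    by rewrite -(qK i) -(qK k) e.
  by rewrite !qK => /ltnW.
have q_ge k : (k <= q k)%N.
  by elim: k => // k IH; apply: leq_ltn_trans IH (q_lt _ _ (ltnSn k)).
by apply/eqP; rewrite eqn_leq p_ge andbT -[X in (_ <= X)%N]pK q_ge.
Qed.

Section SierpinskiGraph.
Implicit Types (f h : nat -> rat) (n m k : nat).

Lemma sierpinski_graph_ltn f n k : (n < k)%N ->
  sierpinski_graph f n k = (f n <= f k).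
Proof.
move=> nk; rewrite /sierpinski_graph /sierpinski_le.
by rewrite neq_ltn nk (ltnW nk) (leqNgt k) nk/= orbF.
Qed.

Lemma sierpinski_graph_lt f n k : f n < f k ->
  sierpinski_graph f n k = (n < k)%N.
Proof.
move=> fnk; rewrite /sierpinski_graph /sierpinski_le (ltW fnk) leNgt fnk/=.
by rewrite andbT andbF orbF ltn_neqAle.
Qed.

Lemma bij_rat_itv_unbounded f (a b : rat) N : bijective f -> a < b ->
  exists2 k, (N <= k)%N & a < f k < b.
Proof.
move=> [g fK gK]; elim: N b => [|N IH] b ab.
  exists (g ((a + b) / 2)) => //.
  by rewrite gK !(midf_lt ab).
have [k Nk /andP[ak kb]] := IH b ab.
move: Nk; rewrite leq_eqVlt => /orP[/eqP Nk|Nk]; last by exists k; rewrite ?ak.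
(* Here [k = N]. Shrinking the interval to end at [f k] forces [f j < f k], so the new index [j]
   cannot be [N]. *)
have [j Nj /andP[aj jk]] := IH _ ak.
exists j; last by rewrite aj (lt_trans jk kb).
rewrite ltn_neqAle Nj andbT; apply: contraTneq jk => Nj'.
by rewrite -Nj' Nk ltxx.
Qed.

(** Past [n] and [m] adjacency only compares values, so a neighbour of [m] missed by [n] has its
    value in [[f m, f n)]. This interval is empty if [f n <= f m]; otherwise it contains values at
    arbitrarily large indices. *)
Lemma le_almost_neighbours f n m : bijective f ->
  f n <= f m <->
  finite_set [set k | sierpinski_graph f m k && ~~ sierpinski_graph f n k].
Proof.
move=> f_bij; split=> [fnm|].
  apply: (@sub_finite_set _ _ `I_(maxn n m).+1); last exact: finite_II.
  move=> k /= /andP[mk]; apply: contraR; rewrite -leqNgt gtn_max => /andP[nk mk'].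
  move: mk; rewrite !sierpinski_graph_ltn//.
  exact: le_trans.
move=> fin; rewrite leNgt; apply/negP => fmn.
pose N := \max_(k <- fset_set
  [set k | sierpinski_graph f m k && ~~ sierpinski_graph f n k]) k.
(* This [k] belongs to the finite exceptional set, yet exceeds its maximum [N]. *)
have [k] := bij_rat_itv_unbounded (maxn N (maxn n m)).+1 f_bij fmn.
rewrite !gtn_max => /and3P[Nk nk mk] /andP[fmk fkn].
have : (k <= N)%N.
  apply: (@leq_bigmax_seq _ _ xpredT id) => //; rewrite in_fset_set// inE/=.
  by rewrite !sierpinski_graph_ltn// (ltW fmk) -ltNge fkn.
by rewrite leqNgt Nk.
Qed.

Lemma graph_isomorphism_value_le f h p : bijective f -> bijective h ->
  graph_isomorphism (sierpinski_graph f) (sierpinski_graph h) p ->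
  forall n m, (h (p n) <= h (p m)) = (f n <= f m).
Proof.
move=> f_bij h_bij [[q pK qK] p_mono] n m.
set B := [set k | sierpinski_graph h (p m) k && ~~ sierpinski_graph h (p n) k].
set A := [set k | sierpinski_graph f m k && ~~ sierpinski_graph f n k].
(* The isomorphism matches the two exceptional sets, and finiteness passes to preimages under the
   injections [p] and [q]. *)
have AB : A = p @^-1` B by apply/funext => k; rewrite /A /B/= !p_mono.
have BA : B = q @^-1` A by rewrite AB; apply/funext => k; rewrite /= qK.
have pI := can_inj pK; have qI := can_inj qK.
apply/idP/idP => [/(le_almost_neighbours _ _ h_bij) fin|
                  /(le_almost_neighbours _ _ f_bij) fin].
  by apply/(le_almost_neighbours _ _ f_bij); rewrite -/A AB;
     apply: finite_preimage => // ? ? _ _; exact: pI.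
by apply/(le_almost_neighbours _ _ h_bij); rewrite -/B BA;
   apply: finite_preimage => // ? ? _ _; exact: qI.
Qed.

Lemma graph_isomorphism_id f h p : bijective f -> bijective h ->
  graph_isomorphism (sierpinski_graph f) (sierpinski_graph h) p -> p = id.
Proof.
move=> f_bij h_bij iso; have [p_bij p_mono] := iso.
have value_le := graph_isomorphism_value_le f_bij h_bij iso.
have value_lt n k : (h (p n) < h (p k)) = (f n < f k).
  by rewrite !ltNge value_le.
apply: bij_homo_lt_id => // n k nk.
(* If values increase from [n] to [k], adjacency reads [n < k] and is preserved. If they decrease,
   it reads [k < n]; this fails, so [p k < p n] fails too, and injectivity excludes equality. *)
have [fnk|fkn|fnk] := ltgtP (f n) (f k).
- by rewrite -(@sierpinski_graph_lt h) ?value_lt// p_mono sierpinski_graph_lt.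
- have := p_mono k n; rewrite !sierpinski_graph_lt ?value_lt// => pkn.
  rewrite ltn_neqAle leqNgt pkn -leqNgt (ltnW nk) andbT.
  by rewrite (bij_eq p_bij) ltn_eqF.
- by move: nk; rewrite (bij_inj f_bij fnk) ltnn.
Qed.

End SierpinskiGraph.

Section SierpinskiNorm.
Context {R : realType}.
Implicit Types (f h : nat -> rat) (x : nat -> R).

(** An injective graph homomorphism sends cliques to cliques and keeps their sums, so each sum on
    the left also occurs on the right. *)
Lemma sierpinski_norm_comp_le f h p x : injective p ->
  {homo p : n k / sierpinski_graph f n k >-> sierpinski_graph h n k} ->
  (sierpinski_norm f (x \o p) <= sierpinski_norm h x)%E.
Proof.
move=> pI p_homo; apply: sierpinski_norm_le => F cF.
have -> : \sum_(i <- F) `|(x \o p) i| = \sum_(j <- [fset p i | i in F]%fset) `|x j|.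
  by rewrite big_imfset//= => ? ? _ _; exact: pI.
apply: sierpinski_norm_ub => _ _ /imfsetP[n /= nF ->] /imfsetP[k /= kF ->] nk.
by apply/p_homo/cF => //; apply: contraNneq nk => ->.
Qed.

Lemma sierpinski_norm_isomorphism f h p x :
  graph_isomorphism (sierpinski_graph f) (sierpinski_graph h) p ->
  sierpinski_norm f (x \o p) = sierpinski_norm h x.
Proof.
move=> [[q pK qK] p_mono]; apply/eqP; rewrite eq_le; apply/andP; split.
  apply: sierpinski_norm_comp_le; first exact: can_inj pK.
  by move=> n k; rewrite p_mono.
(* The reverse inequality is the same lemma for the inverse [q], applied to [x \o p]. *)
have -> : x = (x \o p) \o q by apply/funext => i; rewrite /= qK.
have -> : ((x \o p) \o q) \o p = x \o p by apply/funext => i; rewrite /= pK.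
apply: sierpinski_norm_comp_le; first exact: can_inj qK.
by move=> n k; rewrite -p_mono !qK.
Qed.

Lemma sum_fset_eq (F : {fset nat}) n :
  \sum_(i <- F) (i == n)%:R = (n \in F)%:R :> R.
Proof.
have [nF|nF] := boolP (n \in F).
  rewrite (big_fsetD1 n)//= eqxx big_seq big1 ?addr0// => i.
  by rewrite !inE => /andP[/negPf ->].
rewrite big_seq big1// => i iF; case: eqP => // e.
by rewrite -e iF in nF.
Qed.

(** The sum over a clique counts how many of [n] and [k] it contains; the count 2 is reached exactly
    when the pair is itself a clique. *)
Lemma sierpinski_norm_fset2 f n k : n != k ->
  sierpinski_norm f (fun i => (i \in [fset n; k]%fset)%:R : R) =
  (1 + (sierpinski_graph f n k)%:R)%:E.
Proof.
move=> nk.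
have sumE (F : {fset nat}) : \sum_(i <- F) `|(i \in [fset n; k]%fset)%:R : R| =
    (n \in F)%:R + (k \in F)%:R.
  rewrite -!sum_fset_eq -big_split/=; apply: eq_bigr => i _.
  rewrite normr_nat !inE; have [->|_] := eqVneq i n; last by rewrite add0r.
  by rewrite (negPf nk) addr0.
apply/eqP; rewrite eq_le; apply/andP; split.
  apply: sierpinski_norm_le => F cF; rewrite sumE lee_fin.
  have [nF|_] := boolP (n \in F); last by rewrite add0r -[leLHS]addr0 lerD ?lern1 ?leq_b1.
  have [kF|_] := boolP (k \in F); last by rewrite addr0 lerDl.
  by rewrite (cF n k).
have [nk_adj|_] := boolP (sierpinski_graph f n k); last first.
  rewrite addr0; apply: le_trans (sierpinski_norm_coord _ _ n).
  by rewrite fset21 normr1.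
have cF : finite_cliques f [fset n; k]%fset.
  have kn_adj : sierpinski_graph f k n.
    by move: nk_adj; rewrite /sierpinski_graph eq_sym orbC.
  by move=> i j; rewrite !inE => /orP[]/eqP -> /orP[]/eqP ->; rewrite ?eqxx.
by apply: le_trans (sierpinski_norm_ub _ cF); rewrite sumE fset21 fset22.
Qed.

Lemma norm_sum_unit_vector h (p q : nat -> nat) (c : {fsfun nat -> R with 0}) :
  cancel p q -> cancel q p ->
  `|\sum_(n <- finsupp c) c n *: unit_vector R h (p n)|%:E =
  sierpinski_norm h (c \o q).
Proof.
move=> pK qK; rewrite sierpinski_normE; congr (sierpinski_norm h).
apply/funext => i.
have -> (I : seq nat) :
    (\sum_(n <- I) c n *: unit_vector R h (p n) : sierpinski_space R h) i =
    \sum_(n <- I) c n * (i == p n)%:R.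
  elim: I => [|n I IH]; first by rewrite !big_nil.
  by rewrite !big_cons -IH.
(* Only the term [n = q i] can contribute to coordinate [i]; off the support it is absent and
   [c (q i)] is the default 0. *)
rewrite /=; have [qic|qic] := boolP (q i \in finsupp c); last first.
  rewrite (fsfun_dflt qic) big_seq big1// => n nc; case: eqP => [e|]; last first.
    by rewrite mulr0.
  by rewrite e pK nc in qic.
rewrite (big_fsetD1 (q i))//= qK eqxx mulr1 big_seq big1 ?addr0// => n.
rewrite !inE => /andP[nqi _]; case: eqP => [e|]; last by rewrite mulr0.
by rewrite e pK eqxx in nqi.
Qed.

Lemma isometrically_equivalent_unit_vector f h (p q : nat -> nat) :
  cancel p q -> cancel q p ->
  isometrically_equivalent (unit_vector R f)
    (fun n => unit_vector R h (p n)) <->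
  forall c : {fsfun nat -> R with 0},
    sierpinski_norm f c = sierpinski_norm h (c \o q).
Proof.
move=> pK qK; split=> eq_norm c.
  have := congr1 EFin (eq_norm c); rewrite (norm_sum_unit_vector _ _ pK qK).
  (* The basis for [f] is not permuted, so the formula is used with the identity as its own
     inverse. *)
  by rewrite (@norm_sum_unit_vector _ id id).
apply: EFin_inj; rewrite (norm_sum_unit_vector _ _ pK qK).
by rewrite (@norm_sum_unit_vector _ id id)// eq_norm.
Qed.

Lemma isometrically_equivalent_isomorphism f h p : bijective p ->
  isometrically_equivalent (unit_vector R f)
    (fun n => unit_vector R h (p n)) <->
  graph_isomorphism (sierpinski_graph f) (sierpinski_graph h) p.
Proof.
move=> p_bij; have [q pK qK] := p_bij; split.
  move=> /(isometrically_equivalent_unit_vector _ _ pK qK) eq_norm.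
  split=> // n k; have [->|nk] := eqVneq n k.
    by rewrite /sierpinski_graph !eqxx.
  (* The test sequence is the indicator of the pair, whose norm reveals adjacency; composing with
     [q] moves it to [p n] and [p k]. *)
  pose c := [fsfun i in [fset n; k]%fset => 1 : R | 0]%fset.
  have cE i : c i = (i \in [fset n; k]%fset)%:R.
    by rewrite fsfunE; case: ifP.
  have := eq_norm c.
  have -> : (c : nat -> R) = fun i => (i \in [fset n; k]%fset)%:R.
    exact/funext.
  have -> : (fun i => (i \in [fset n; k]%fset)%:R) \o q =
      (fun i => (i \in [fset p n; p k]%fset)%:R : R).
    by apply/funext => i; rewrite /= !inE !(can2_eq qK pK).
  rewrite !sierpinski_norm_fset2 ?(bij_eq p_bij)// => -[] /addrI /eqP.
  by rewrite eqr_nat; do 2![case: sierpinski_graph].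
move=> iso; apply/(isometrically_equivalent_unit_vector _ _ pK qK) => c.
rewrite -(sierpinski_norm_isomorphism _ iso); congr (sierpinski_norm f).
by apply/funext => n; rewrite /= pK.
Qed.

End SierpinskiNorm.

Theorem proposition5p1 (R : realType) (f h : nat -> rat) (pi : nat -> nat)
    (f_bij : bijective f) (h_bij : bijective h) (pi_bij : bijective pi) :
  [<-> graph_isomorphism (sierpinski_graph f) (sierpinski_graph h) pi;
       isometrically_equivalent (unit_vector R f)
         (fun n => unit_vector R h (pi n));
       pi = id /\ exists e : rat -> rat, order_isomorphism e /\ f = e \o h].
Proof.
tfae.
- exact: (isometrically_equivalent_isomorphism _ _ pi_bij).2.
- move=> /(isometrically_equivalent_isomorphism _ _ pi_bij) iso.
  have pi_id := graph_isomorphism_id f_bij h_bij iso; split=> //.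
  have := graph_isomorphism_value_le f_bij h_bij iso; rewrite pi_id => value_le.
  (* With [g] inverse to [h], the equation [f = e \o h] forces [e = f \o g]; it preserves order by
     [value_le] at [g a] and [g b]. *)
  have [g hK gK] := h_bij; exists (f \o g); split; last first.
    by apply/funext => n; rewrite /= hK.
  split; first by apply: bij_comp => //; exists h.
  by move=> a b; rewrite /= -value_le !gK.
- move=> [-> [e [[_ e_mono] ->]]]; split; first by exists id.
  by move=> n k; rewrite /sierpinski_graph /sierpinski_le /= !e_mono.
Qed.
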